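(* Let $N\ge 1$, let $K\in\mathbb{N}\cup\{\infty\}$, let $0<\epsilon,\delta<1$, let $B$ be a real symmetric $N\times N$ matrix all of whose eigenvalues lie strictly between $0$ and $1$, and let $a_I\in\mathbb{R}$ for $I\in\mathbb{N}^N$ with $|I|$ even and $|I|\le 2K$. Suppose $|\mu_{\mathrm{Haf}^2}|>\mu_0$ for some $\mu_0>0$. Suppose there exist real numbers $c_1,c_2,q_1,q_2,\gamma_1,\gamma_2$ such that for all $1\le k\le K$ ($k<\infty$) $$\sum_{|I|=2k}|a_I|\le c_1\frac{k^{q_1}\gamma_1^{k}}{(2k)!}\qquad\text{and}\qquad \sum_{|I|=2k}a_I^2\,I!\le c_2\frac{k^{q_2}\gamma_2^{k}}{(2k)!}.$$ If $K=\infty$, suppose also that $\gamma_1<\frac1{b_{\max}^2}$ and $\gamma_2<\frac1{b_{\max}^2}$. Then $$n^{\mathrm{GBS\text{-}I}}_{\mathrm{Haf}^2}\le \frac{1}{d\,\delta\,\epsilon^2}\,\frac{1}{\mu_0^2}\left(a_0^2+\frac{c_2}{\sqrt\pi}\,\mathrm{Li}_{\frac12-q_2,K}\!\left(\gamma_2 b_{\max}^2\right)\right)-\frac1{\delta\epsilon^2}.$$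
   Context: $\mathbb{N}=\{0,1,2,\dots\}$. For $I=(i_1,\dots,i_N)\in\mathbb{N}^N$: $|I|=i_1+\cdots+i_N$, $I!=i_1!\cdots i_N!$; $a_0$ denotes the coefficient $a_{(0,\dots,0)}$. Hafnian: for a $2m\times 2m$ matrix $M$, $m\ge 1$, $\mathrm{Haf}(M)=\frac{1}{m!2^m}\sum_{\sigma\in S_{2m}}\prod_{j=1}^m M_{\sigma(2j-1),\sigma(2j)}$; the hafnian of the empty matrix is $1$. For an $N\times N$ matrix $B$ and $I\in\mathbb{N}^N$, $B_I$ is the $|I|\times|I|$ matrix obtained from $B$ by repeating the $n$-th row and the $n$-th column $i_n$ times each (deleting them if $i_n=0$). $b_{\max}$ is the maximum of the absolute values of the entries of $B$. $d=\prod_{j=1}^N\sqrt{1-\lambda_j^2}$, where $\lambda_1,\dots,\lambda_N$ are the eigenvalues of $B$. Quantities (all sums over $k$ run over finite $k$ with $0\le k\le K$): $$\mu_{\mathrm{Haf}^2}=\sum_{k=0}^K\sum_{|I|=2k}a_I\,\mathrm{Haf}(B_I)^2,\qquad Q=\frac1d\sum_{k=0}^K\sum_{|I|=2k}a_I^2\,I!\,\mathrm{Haf}(B_I)^2,\qquad n^{\mathrm{GBS\text{-}I}}_{\mathrm{Haf}^2}=\frac{Q-\mu_{\mathrm{Haf}^2}^2}{\delta\epsilon^2\mu_{\mathrm{Haf}^2}^2}.$$ ($\mu_{\mathrm{Haf}^2}$ is the expectation of $\sum_I a_I p^Iq^I$ for independent $p,q\sim\mathcal N(0,B)$; $n^{\mathrm{GBS\text{-}I}}_{\mathrm{Haf}^2}$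 is the guaranteed sample size of the importance estimator.) Truncated polylogarithm: $\mathrm{Li}_{s,K}(z)=\sum_{k=1}^K \frac{z^k}{k^s}$ (with $\mathrm{Li}_{s,0}(z)=0$, defined for all real $z$ if $K<\infty$, and for $|z|<1$ if $K=\infty$). *)

(* Defs.v *)
From HB Require Import structures.
From mathcomp Require Import all_boot all_order all_algebra all_fingroup.
From mathcomp Require Import all_classical all_reals all_analysis.
Set Implicit Arguments.
Unset Strict Implicit.
Unset Printing Implicit Defensive.
Import Order.TTheory GRing.Theory Num.Theory.
Import numFieldNormedType.Exports.
Local Open Scope ring_scope.

Definition multiindex (N : nat) := {ffun 'I_N -> nat}.

Definition mi_size N (I : multiindex N) : nat := (\sum_(n < N) I n)%N.

Definition mi_fact N (I : multiindex N) : nat := (\prod_(n < N) (I n)`!)%N.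

Definition mi0 N : multiindex N := [ffun => 0%N].

Definition mi_of_bounded N d (J : {ffun 'I_N -> 'I_d.+1}) : multiindex N :=
  [ffun n => J n : nat].

(* Every entry of a multi-index of size d is at most d, so ranging over the
   finite type {ffun 'I_N -> 'I_d.+1} reaches each of them exactly once. *)
Definition sum_of_size (R : realType) N (d : nat) (F : multiindex N -> R) : R :=
  \sum_(J : {ffun 'I_N -> 'I_d.+1} | mi_size (mi_of_bounded J) == d)
    F (mi_of_bounded J).

Lemma half_index0 n (j : 'I_n./2) : (j.*2 < n)%N.
Proof.
apply: leq_trans (_ : n./2.*2 <= n)%N; first by rewrite ltn_double.
by rewrite -[leqRHS]odd_double_half leq_addl.
Qed.

Lemma half_index1 n (j : 'I_n./2) : (j.*2.+1 < n)%N.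
Proof.
apply: leq_trans (_ : n./2.*2 <= n)%N; first by rewrite -doubleS leq_double.
by rewrite -[leqRHS]odd_double_half leq_addl.
Qed.

(* Indices start at 0, so the pair (2j-1, 2j), 1 <= j <= m, becomes
   (2j, 2j+1), 0 <= j < m, with m = n./2.  Odd sizes get the usual value 0. *)
Definition haf (R : realType) n (M : 'M[R]_n) : R :=
  if odd n then 0 else
  (n./2`!%:R * 2 ^+ n./2)^-1 *
  \sum_(s : 'S_n) \prod_(j < n./2)
     M (s (Ordinal (half_index0 j))) (s (Ordinal (half_index1 j))).

Definition repeat_mx (R : realType) N (B : 'M[R]_N) (I : multiindex N) :
    'M[R]_(\sum_(n < N) I n) :=
  \mxblock_(i < N, j < N) (const_mx (B i j) : 'M[R]_(I i, I j)).

Definition bmax (R : realType) N (B : 'M[R]_N) : R :=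
  \big[Order.max/0]_(ij : 'I_N * 'I_N) `|B ij.1 ij.2|.

(* The upper bound K ranges over N u {oo}, with None standing for oo. *)
Definition leq_upto (k : nat) (K : option nat) : bool :=
  if K is Some m then (k <= m)%N else true.

Definition sum_upto (R : realType) (m : nat) (K : option nat) (u : nat -> R) : R :=
  if K is Some n then \sum_(m <= k < n.+1) u k else limn (fun n => \sum_(m <= k < n) u k).

Definition mu_haf2 (R : realType) N (K : option nat) (B : 'M[R]_N)
    (a : multiindex N -> R) : R :=
  sum_upto 0 K (fun k =>
    sum_of_size k.*2 (fun I => a I * haf (repeat_mx B I) ^+ 2)).

(* lambda lists the eigenvalues of B with multiplicity *)
Definition is_spectrum (R : realType) N (B : 'M[R]_N) (lambda : 'I_N -> R) : Prop :=
  char_poly B = \prod_(j < N) ('X - (lambda j)%:P).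

Definition d_of (R : realType) N (lambda : 'I_N -> R) : R :=
  \prod_(j < N) Num.sqrt (1 - lambda j ^+ 2).

Definition Q_haf2 (R : realType) N (K : option nat) (B : 'M[R]_N)
    (lambda : 'I_N -> R) (a : multiindex N -> R) : R :=
  (d_of lambda)^-1 *
  sum_upto 0 K (fun k =>
    sum_of_size k.*2 (fun I =>
      a I ^+ 2 * (mi_fact I)%:R * haf (repeat_mx B I) ^+ 2)).

Definition n_gbs_i (R : realType) N (K : option nat) (eps delta : R)
    (B : 'M[R]_N) (lambda : 'I_N -> R) (a : multiindex N -> R) : R :=
  (Q_haf2 K B lambda a - mu_haf2 K B a ^+ 2) /
  (delta * eps ^+ 2 * mu_haf2 K B a ^+ 2).

Definition polylog_trunc (R : realType) (s : R) (K : option nat) (z : R) : R :=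
  sum_upto 1 K (fun k => z ^+ k / k%:R `^ s).

(* Main.v *)
(** Bounding every product in the hafnian by powers of [bmax B] gives
    [haf(B_I)^2 <= ((2k)! / (k! 2^k))^2 bmax^(2k)] for [|I| = 2k].  Against the
    hypothesis on [a_I^2 I!] there remains the factor ['C(2k, k) / 4^k], which is
    at most [1 / sqrt (pi k)] by Wallis' product; summing over [k] produces the
    polylogarithm.  The rest follows from [mu0^2 < mu^2] and [Q >= 0]. *)
Require Import Defs.
From HB Require Import structures.
From mathcomp Require Import all_boot all_order all_algebra all_fingroup.
From mathcomp Require Import all_classical all_reals all_analysis.
From mathcomp Require Import ring lra.
Set Implicit Arguments.
Unset Strict Implicit.
Unset Printing Implicit Defensive.
Import Order.TTheory GRing.Theory Num.Theory.
Import numFieldNormedType.Exports.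
Local Open Scope ring_scope.

(** * Wallis integrals and the central binomial coefficient *)

(* Integrals of [sin ^ n] over [0, pi / 2]. *)
Fixpoint wallis (R : realType) (n : nat) : R :=
  match n with
  | 0 => pi / 2
  | 1 => 1
  | m.+2 => m.+1%:R / m.+2%:R * wallis R m
  end.

(** Integration by parts: differentiating [sin ^+ n.+1 * cos] produces the recurrence of [wallis].
    Explicit primitives stand in for integrals; only their derivatives and their values at [0] and
    [pi / 2] are used later. *)
Lemma wallis_sinX_primitive (R : realType) (n : nat) :
  exists F : R -> R, [/\ forall x : R, is_derive x 1 F (sin x ^+ n),
    F 0 = 0 & F (pi / 2) = wallis R n].
Proof.
elim/ltn_ind: n => -[|[|n]] IH.
- by exists id; split => // x; apply: is_derive_eq.
- exists (fun x => 1 - cos x); split => [x||]; rewrite ?cos0 ?cos_pihalf; last 2 first.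
  + by rewrite subrr.
  + by rewrite subr0.
  by apply: is_derive_eq; rewrite /GRing.scale /=; ring.
have [//|F [dF F0 Fp]] := IH n.
exists (n.+2%:R^-1 *: (n.+1%:R *: F - sin ^+ n.+1 * cos)).
split => [x||].
- have dFx := dF x.
  apply: is_derive_eq.
  rewrite /GRing.scale !fctE /= !exprS.
  transitivity (n.+2%:R^-1 * (sin x ^+ n *
      (n.+1%:R + sin x ^+ 2 - n.+1%:R * cos x ^+ 2))); first by ring.
  rewrite cos2sin2 -[n.+2%:R]natr1; field.
  by rewrite nat1r natr1 pnatr_eq0.
- rewrite !fctE /GRing.scale /= F0 sin0.
  by rewrite expr0n /= !(mulr0, mul0r) subrr mulr0.
- rewrite !fctE /GRing.scale /= Fp cos_pihalf.
  by rewrite mulr0 subr0 mulrA [_^-1 * _]mulrC.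
Qed.

(** Since [0 <= sin x <= 1] between [0] and [pi / 2], the difference of the two primitives is
    nondecreasing there. *)
Lemma wallis_nincr (R : realType) (n : nat) : wallis R n.+1 <= wallis R n.
Proof.
have [F [dF F0 <-]] := wallis_sinX_primitive R n.
have [G [dG G0 <-]] := wallis_sinX_primitive R n.+1.
have dFG (x : R) : is_derive x 1 (fun x => F x - G x) (sin x ^+ n - sin x ^+ n.+1).
  by have := dF x; have := dG x => ? ?; apply: is_derive_eq.
have pi2 : 0 <= pi / 2 :> R by rewrite divr_ge0 ?pi_ge0.
have : F 0 - G 0 <= F (pi / 2) - G (pi / 2); last by rewrite F0 G0 subrr subr_ge0.
apply: (@ger0_derive1_ndecr R (fun x => F x - G x) 0 (pi / 2)) => //.
- move=> x; rewrite in_itv /= => /sin_gt0_pihalf/ltW s0.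
  rewrite derive1E (@derive_val _ _ _ _ _ _ _ (dFG x)).
  by rewrite subr_ge0 exprS ler_piMl ?exprn_ge0 ?sin_le1.
- apply: continuous_subspaceT => x.
  apply: differentiable_continuous; apply/derivable1_diffP.
  by case: (dFG x).
Qed.

(** The recurrence makes the left side independent of [n]. *)
Lemma wallisM (R : realType) (n : nat) :
  n.+1%:R * wallis R n * wallis R n.+1 = pi / 2.
Proof.
elim: n => [|n IH]; first by rewrite /= mulr1 mul1r.
rewrite -[RHS]IH (_ : wallis R n.+2 = n.+1%:R / n.+2%:R * wallis R n) // -!natr1.
field.
by rewrite !natr1 pnatr_eq0.
Qed.

Lemma wallis_double (R : realType) (k : nat) :
  wallis R k.*2 = pi / 2 * ((k.*2)`!%:R / (k`!%:R ^+ 2 * 4 ^+ k)).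
Proof.
elim: k => [|k IH]; first by rewrite /= fact0 expr1n expr0 mulr1 divr1 mulr1.
rewrite doubleS /= IH !factS !natrM [4 ^+ k.+1]exprS.
rewrite -[k.*2.+2%:R]natr1 -[k.*2.+1%:R]natr1 -[k.+1%:R]natr1 -muln2 natrM.
field.
by rewrite -natrM !natr1 !pnatr_eq0 -lt0n fact_gt0 /= expf_neq0 // pnatr_eq0.
Qed.

(** The left side [r] is ['C(2k, k) / 4^k], so [wallis R k.*2 = pi / 2 * r]. Then [wallisM] at
    [2k - 1] and monotonicity give [2k * (pi / 2 * r) ^+ 2 <= pi / 2], that is
    [pi * k * r ^+ 2 <= 1]. *)
Lemma central_binomial_le (R : realType) (k : nat) : (0 < k)%N ->
  (k.*2)`!%:R / (k`!%:R ^+ 2 * 4 ^+ k) <= (Num.sqrt pi)^-1 / Num.sqrt k%:R :> R.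
Proof.
case: k => // k _.
have pi0 : 0 < pi :> R := pi_gt0 R.
set r := _ / _.
have r0 : 0 <= r by rewrite divr_ge0 ?mulr_ge0 ?exprn_ge0.
have wr : wallis R k.+1.*2 = pi / 2 * r := wallis_double R k.+1.
have := wallisM R k.*2.+1; rewrite -doubleS wr => wM.
have := wallis_nincr R k.*2.+1; rewrite -doubleS wr => ww.
have r2 : pi * k.+1%:R * r ^+ 2 <= 1.
  have : k.+1.*2%:R * (pi / 2 * r) * (pi / 2 * r) <= pi / 2 :> R.
    rewrite -[leRHS]wM; apply: ler_wpM2r => //.
      by rewrite !mulr_ge0 ?invr_ge0 // ltW.
    by apply: ler_wpM2l.
  rewrite -muln2 natrM -subr_ge0 => h; rewrite -subr_ge0.
  rewrite -(pmulr_rge0 _ (_ : 0 < pi / 2)); last by rewrite divr_gt0.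
  by apply: le_trans h _; rewrite le_eqVlt; apply/orP; left; apply/eqP; field.
rewrite -invfM -sqrtrM ?pi_ge0 // -[leLHS]ger0_norm // -sqrtr_sqr -sqrtrV; last first.
  by rewrite mulr_ge0 ?ltW.
by rewrite ler_wsqrtr // -[leRHS]mul1r ler_pdivlMr ?mulr_gt0 // mulrC.
Qed.

(** * Bounds on hafnians *)

Lemma entry_le_bmax (R : realType) N (B : 'M[R]_N) i j : `|B i j| <= bmax B.
Proof. exact: (le_bigmax 0 (fun ij : 'I_N * 'I_N => `|B ij.1 ij.2|) (i, j)). Qed.

Lemma bmax_ge0 (R : realType) N (B : 'M[R]_N) : 0 <= bmax B.
Proof. exact: bigmax_ge_id. Qed.

(** Triangle inequality over all permutations, each contributing a product of [n./2] entries. *)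
Lemma norm_haf_le (R : realType) n (M : 'M[R]_n) (b : R) : ~~ odd n ->
  (forall i j, `|M i j| <= b) ->
  `|haf M| <= n`!%:R / (n./2`!%:R * 2 ^+ n./2) * b ^+ n./2.
Proof.
move=> /negbTE no Mb; rewrite /haf no normrM ger0_norm; last first.
  by rewrite invr_ge0 mulr_ge0 ?exprn_ge0.
rewrite mulrAC [leRHS]mulrC; apply: ler_wpM2l.
  by rewrite invr_ge0 mulr_ge0 ?exprn_ge0.
apply: le_trans (ler_norm_sum _ _ _) _.
apply: le_trans (_ : \sum_(s : 'S_n) b ^+ n./2 <= _); last first.
  by rewrite sumr_const card_Sn mulr_natl.
apply: ler_sum => s _; rewrite normr_prod.
rewrite -[X in b ^+ X]card_ord -prodr_const; apply: ler_prod => j _.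
by rewrite normr_ge0 Mb.
Qed.

Lemma sqr_haf_repeat_mx_le (R : realType) N (B : 'M[R]_N) (I : multiindex N) k :
  mi_size I = k.*2 ->
  haf (repeat_mx B I) ^+ 2 <=
    ((k.*2)`!%:R / (k`!%:R * 2 ^+ k)) ^+ 2 * (bmax B ^+ 2) ^+ k.
Proof.
move=> sI; have sz : (\sum_(n < N) I n)%N = k.*2 := sI.
have le : `|haf (repeat_mx B I)| <= (k.*2)`!%:R / (k`!%:R * 2 ^+ k) * bmax B ^+ k.
  (* The type of [repeat_mx B I] depends on the sum, so [sz] is rewritten in the numerical bound and
     not in the matrix. *)
  have := @norm_haf_le R _ (repeat_mx B I) (bmax B).
  have -> : (\sum_(n < N) I n)./2 = k by rewrite sz doubleK.
  have -> : (\sum_(n < N) I n)`! = (k.*2)`! by rewrite sz.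
  apply => [|i j]; first by rewrite sz odd_double.
  by rewrite /repeat_mx /mxblock !mxE entry_le_bmax.
rewrite exprAC -exprMn -[leLHS]ger0_norm ?sqr_ge0 // normrX.
by apply: lerXn2r => //; rewrite nnegrE // (le_trans _ le).
Qed.

(** * The term [k = 0] *)

Lemma sum_of_size0 (R : realType) N (F : multiindex N -> R) :
  sum_of_size 0 F = F (mi0 N).
Proof.
rewrite /sum_of_size (big_pred1 [ffun=> ord0]) => [|J].
  by congr F; apply/ffunP => n; rewrite !ffunE.
transitivity true; last by apply/esym/eqP/ffunP => n; rewrite !ffunE ord1.
apply/eqP; rewrite /mi_size big1 // => n _.
by rewrite ffunE ord1.
Qed.

Lemma haf_repeat_mx0 (R : realType) N (B : 'M[R]_N) : haf (repeat_mx B (mi0 N)) = 1.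
Proof.
have sz : (\sum_(n < N) mi0 N n)%N = 0%N by rewrite big1 // => n _; rewrite ffunE.
(* Once the matrix is generalized its dimension can be rewritten to [0], leaving one permutation and
   an empty product. *)
move: (repeat_mx _ _); rewrite sz => M.
rewrite /haf /= fact0 expr0 mulr1 invr1 mul1r (eq_bigr (fun=> 1)) => [|s _].
  by rewrite sumr_const card_Sn fact0.
by rewrite big_ord0.
Qed.

Lemma mi_fact_mi0 N : mi_fact (mi0 N) = 1%N.
Proof. by rewrite /mi_fact big1 // => n _; rewrite ffunE. Qed.

(** * Boundedness of the polylogarithm series *)

Lemma polylog_trunc_bounded (R : realType) (s z : R) : 0 <= z < 1 ->
  exists M, forall n, \sum_(1 <= k < n) z ^+ k / k%:R `^ s <= M.
Proof.
(* The case [z = 0] is split off because the comparison below uses [ln z < 0]. *)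
case/andP; rewrite le_eqVlt => /predU1P[<- _|z0 z1].
  exists 0 => n; rewrite big_nat_cond big1 // => k /andP[/andP[k1 _] _].
  by rewrite expr0n gtn_eqF // mul0r.
(* From [ln (e k) < e k], [k ^ (- s) <= A exp (|s| e k)]; this [e] leaves
   [z exp (|s| e) = exp (- e) < 1]. *)
pose e := - ln z / (`|s| + 1).
have s1 : 0 < `|s| + 1 by rewrite ltr_wpDl.
have lz : ln z < 0 by rewrite ln_lt0 // z0.
have e0 : 0 < e by rewrite divr_gt0 ?oppr_gt0.
pose A := expR (- (`|s| * ln e)); pose q := expR (- e).
have q0 : 0 < q by rewrite expR_gt0.
have q1 : q < 1 by rewrite expR_lt1 oppr_lt0.
have term k : (0 < k)%N -> z ^+ k / k%:R `^ s <= A * q ^+ k.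
  move=> k0; have kR : 0 < k%:R :> R by rewrite ltr0n.
  rewrite -(lnK z0) -!expRM_natr -powRN /powR gt_eqF // -!expRD ler_expR.
  have /ltW := ln_sublinear (mulr_gt0 e0 kR).
  rewrite lnM ?posrE // -lerBrDl => lnk.
  have -> : ln z = - (e * (`|s| + 1)) by rewrite /e divfK ?gt_eqF ?opprK.
  have : - s * ln k%:R <= `|s| * (e * k%:R - ln e).
    apply: le_trans (ler_wpM2l (normr_ge0 s) lnk).
    by rewrite ler_wpM2r ?ln_ge0 ?ler1n // -normrN ler_norm.
  by lra.
exists (A / (1 - q)) => n.
apply: le_trans (_ : \sum_(1 <= k < n) A * q ^+ k <= _).
  rewrite !big_seq; apply: ler_sum => k; rewrite mem_index_iota => /andP[k0 _].
  exact: term.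
apply: le_trans (geometric_le_lim n (expR_ge0 _) q0 _); last by rewrite ger0_norm // ltW.
rewrite /series /=; case: n => [|n]; first by rewrite !big_geq.
by rewrite [leRHS]big_ltn // lerDr mulr_ge0 ?exprn_ge0 ?expR_ge0.
Qed.

(** * Termwise bound and summation over [k] *)

Lemma sum_of_size_ge0 (R : realType) N d (F : multiindex N -> R) :
  (forall I, 0 <= F I) -> 0 <= sum_of_size d F.
Proof. by move=> F0; apply: sumr_ge0. Qed.

(** The squared hafnian bound equals [(2k)!] times ['C(2k, k) / 4^k] times a power of [bmax B]. The
    factorial cancels the denominator of the hypothesis, and the factor [1 / sqrt k] turns the
    exponent [p] into [p - 1/2]. *)
Lemma sum_of_size_sqr_haf_le (R : realType) N (B : 'M[R]_N)
    (w : multiindex N -> R) (c p g : R) (k : nat) :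
  (0 < k)%N -> (forall I, 0 <= w I) ->
  sum_of_size k.*2 w <= c * (k%:R `^ p * g ^+ k / (k.*2)`!%:R) ->
  sum_of_size k.*2 (fun I => w I * haf (repeat_mx B I) ^+ 2) <=
    c / Num.sqrt pi * ((g * bmax B ^+ 2) ^+ k / k%:R `^ (2^-1 - p)).
Proof.
move=> k0 w0 le; have kR : 0 < k%:R :> R by rewrite ltr0n.
set h := ((k.*2)`!%:R / (k`!%:R * 2 ^+ k)) ^+ 2 * (bmax B ^+ 2) ^+ k : R.
have h0 : 0 <= h by rewrite mulr_ge0 ?sqr_ge0 // exprn_ge0 // sqr_ge0.
apply: le_trans (_ : sum_of_size k.*2 w * h <= _).
  rewrite /sum_of_size mulr_suml; apply: ler_sum => J /eqP sJ.
  by apply: ler_wpM2l => //; exact: sqr_haf_repeat_mx_le.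
set r : R := (k.*2)`!%:R / (k`!%:R ^+ 2 * 4 ^+ k).
have f0 n : n`!%:R != 0 :> R by rewrite pnatr_eq0 -lt0n fact_gt0.
have hE : h = (k.*2)`!%:R * r * (bmax B ^+ 2) ^+ k.
  have p4 : 4 ^+ k = (2 ^+ k) ^+ 2 :> R by rewrite exprAC; congr (_ ^+ _); ring.
  rewrite /h /r p4.
  by field; rewrite f0 expf_neq0.
rewrite hE; set W := sum_of_size _ _ in le *.
have W0 : 0 <= W by exact: sum_of_size_ge0.
have r_le : r <= _ := central_binomial_le R k0.
have Wf : W * (k.*2)`!%:R <= c * (k%:R `^ p * g ^+ k).
  by rewrite -ler_pdivlMr ?ltr0n ?fact_gt0 // -mulrA.
apply: le_trans (_ : c * (k%:R `^ p * g ^+ k) *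
    ((Num.sqrt pi)^-1 / Num.sqrt k%:R) * (bmax B ^+ 2) ^+ k <= _).
  rewrite !(mulrA W); apply: ler_wpM2r; first by rewrite exprn_ge0 ?sqr_ge0.
  (* The signs of [c] and [g] are unknown; the product of inequalities rests on [W] and [r] being
     nonnegative. *)
  apply: ler_pM => //.
    by rewrite mulr_ge0.
  by rewrite divr_ge0 ?mulr_ge0 ?exprn_ge0.
rewrite powRB; last by rewrite (gt_eqF kR) implybT.
rewrite powR12_sqrt // [(g * _) ^+ k]exprMn invf_div.
by rewrite le_eqVlt; apply/orP; left; apply/eqP; ring.
Qed.

(** For [K = None] the sums are values of [limn], meaningful only under convergence, which monotone
    bounded partial sums provide. The guard [c != 0] is there because [u] can be controlled only in
    that case. *)
Lemma sum_upto_le (R : realType) (K : option nat) (t u : nat -> R) (c : R) :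
  (forall k, 0 <= t k) ->
  (forall k, (1 <= k)%N -> leq_upto k K -> t k <= c * u k) ->
  (K = None -> c != 0 -> (forall k, 0 <= u k) /\
     exists M, forall n, \sum_(1 <= k < n) u k <= M) ->
  0 <= sum_upto 0 K t <= t 0%N + c * sum_upto 1 K u.
Proof.
case: K => [n|] t0 tu /=.
  move=> _; rewrite sumr_ge0 //= big_ltn // lerD2l mulr_sumr !big_seq.
  apply: ler_sum => k; rewrite mem_index_iota => /andP[k1 kn]; exact: tu.
move=> /(_ erefl) cu.
have ndecr (v : nat -> R) m : (forall k, (m <= k)%N -> 0 <= v k) ->
    nondecreasing_seq (fun n => \sum_(m <= k < n) v k).
  move=> v0; apply/nondecreasing_seqP => n.
  have [mn|nm] := leqP m n; first by rewrite big_nat_recr //= lerDl v0.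
  by rewrite !big_geq // ltnW.
have bound n : \sum_(0 <= k < n) t k <= t 0%N + c * limn (fun n => \sum_(1 <= k < n) u k).
  apply: le_trans (_ : t 0%N + \sum_(1 <= k < n) c * u k <= _).
    case: n => [|n].
      by rewrite !big_geq // addr0.
    rewrite big_ltn // lerD2l !big_seq.
    by apply: ler_sum => k; rewrite mem_index_iota => /andP[k1 _]; exact: tu.
  (* For [c = 0] the limit of the sums of [u], possibly a default value, is multiplied by [0]. *)
  rewrite lerD2l; have [->|c0] := eqVneq c 0.
    by rewrite mul0r big1 // => k _; rewrite mul0r.
  have [u0 [M uM]] := cu c0.
  have ucvg : cvgn (fun n => \sum_(1 <= k < n) u k).
    apply: nondecreasing_is_cvgn; first by apply: ndecr.
    by exists M => _ [m _ <-].
  have cucvg : ((fun n => \sum_(1 <= k < n) c * u k) @ \oo -->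
      c * limn (fun n => \sum_(1 <= k < n) u k))%classic.
    under eq_fun do rewrite -mulr_sumr.
    exact: cvgMr ucvg.
  (* The partial sums increase because each [c * u k] dominates [t k >= 0]. *)
  rewrite -(cvg_lim _ cucvg) //; apply: nondecreasing_cvgn_le; last exact: cvgP cucvg.
  by apply: ndecr => k k1; apply: le_trans (tu k k1 isT).
have tcvg : cvgn (fun n => \sum_(0 <= k < n) t k).
  apply: nondecreasing_is_cvgn; first by apply: ndecr.
  by eexists => _ [m _ <-]; exact: bound.
apply/andP; split.
  by apply: limr_ge => //; apply: nearW => n; exact: sumr_ge0.
by apply: limr_le => //; apply: nearW.
Qed.

(** * Positivity of [d] and the final estimate *)

Lemma d_of_gt0 (R : realType) N (B : 'M[R]_N) (lambda : 'I_N -> R) :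
  (forall x : R, eigenvalue B x -> 0 < x < 1) -> is_spectrum B lambda ->
  0 < d_of lambda.
Proof.
move=> B01 spec; apply: prodr_gt0 => j _; rewrite sqrtr_gt0 subr_gt0.
have /B01/andP[l0 l1] : eigenvalue B (lambda j).
  rewrite eigenvalue_root_char spec /root horner_prod; apply/prodf_eq0.
  by exists j => //; rewrite hornerXsubC subrr.
by rewrite expr_lt1 // ltW.
Qed.

Theorem theorem1p1 (R : realType) (N : nat) (hN : (1 <= N)%N) (K : option nat)
  (eps delta : R) (heps : 0 < eps < 1) (hdelta : 0 < delta < 1)
  (B : 'M[R]_N) (hBsym : B^T = B)
  (hBeig : forall x : R, eigenvalue B x -> 0 < x < 1)
  (lambda : 'I_N -> R) (hlambda : is_spectrum B lambda)
  (a : multiindex N -> R)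
  (mu0 : R) (hmu0 : 0 < mu0) (hmu : mu0 < `|mu_haf2 K B a|)
  (c1 c2 q1 q2 gamma1 gamma2 : R)
  (h1 : forall k : nat, (1 <= k)%N -> leq_upto k K ->
     sum_of_size k.*2 (fun I => `|a I|)
       <= c1 * (k%:R `^ q1 * gamma1 ^+ k / (k.*2)`!%:R))
  (h2 : forall k : nat, (1 <= k)%N -> leq_upto k K ->
     sum_of_size k.*2 (fun I => a I ^+ 2 * (mi_fact I)%:R)
       <= c2 * (k%:R `^ q2 * gamma2 ^+ k / (k.*2)`!%:R))
  (hinf : K = None ->
     gamma1 < 1 / bmax B ^+ 2 /\ gamma2 < 1 / bmax B ^+ 2) :
  n_gbs_i K eps delta B lambda a
    <= 1 / (d_of lambda * delta * eps ^+ 2) * (1 / mu0 ^+ 2)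
       * (a (mi0 N) ^+ 2
          + c2 / Num.sqrt pi * polylog_trunc (2^-1 - q2) K (gamma2 * bmax B ^+ 2))
       - 1 / (delta * eps ^+ 2).
Proof.
have d0 := d_of_gt0 hBeig hlambda.
have [/andP[e0 _] /andP[dl0 _]] := (heps, hdelta).
pose w (I : multiindex N) := a I ^+ 2 * (mi_fact I)%:R.
have w0 I : 0 <= w I by rewrite mulr_ge0 ?sqr_ge0.
pose t k := sum_of_size k.*2 (fun I => w I * haf (repeat_mx B I) ^+ 2).
pose u k := (gamma2 * bmax B ^+ 2) ^+ k / k%:R `^ (2^-1 - q2).
have t0 k : 0 <= t k by apply: sum_of_size_ge0 => I; rewrite mulr_ge0 ?sqr_ge0.
have t_0 : t 0%N = a (mi0 N) ^+ 2.
  by rewrite /t sum_of_size0 /w haf_repeat_mx0 mi_fact_mi0 expr1n !mulr1.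
have tu k : (1 <= k)%N -> leq_upto k K -> t k <= c2 / Num.sqrt pi * u k.
  by move=> k1 kK; apply: sum_of_size_sqr_haf_le => //; exact: h2.
have uK : K = None -> c2 / Num.sqrt pi != 0 -> (forall k, 0 <= u k) /\
    exists M, forall n, \sum_(1 <= k < n) u k <= M.
  move=> KN; rewrite mulf_eq0 negb_or => /andP[c20 _].
  (* The left side of [h2] is nonnegative, hence so is its right side; its positive factors are
     divided out. *)
  have cg k : (1 <= k)%N -> 0 <= c2 * gamma2 ^+ k.
    move=> k1; have kK : leq_upto k K by rewrite KN.
    have := le_trans (sum_of_size_ge0 k.*2 w0) (h2 k k1 kK).
    rewrite -(pmulr_lge0 (c2 * gamma2 ^+ k) (_ : 0 < k%:R `^ q2 / (k.*2)`!%:R)).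
      by congr (0 <= _); ring.
    by rewrite divr_gt0 ?powR_gt0 ?ltr0n ?fact_gt0.
  (* If [gamma2 < 0], then [cg] at 1 and 2 forces [c2 = 0]. *)
  have g0 : 0 <= gamma2.
    rewrite leNgt; apply/negP => g_lt0; move: c20; rewrite eq_le.
    have := cg 1%N isT; rewrite nmulr_lge0 // => ->.
    by have := cg 2 isT; rewrite pmulr_lge0 ?exprn_even_gt0 //= ?lt_eqF // => ->.
  have z0 : 0 <= gamma2 * bmax B ^+ 2 by rewrite mulr_ge0 ?sqr_ge0.
  split=> [k|]; first by rewrite divr_ge0 ?powR_ge0 ?exprn_ge0.
  apply: polylog_trunc_bounded; rewrite z0 /=.
  (* If [bmax B = 0], then [1 / bmax B ^+ 2] is the default value [0], but the argument of the
     series is [0 < 1]. *)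
  have [_] := hinf KN; have [->|b0] := eqVneq (bmax B) 0.
    by rewrite expr0n mulr0.
  by rewrite ltr_pdivlMr // exprn_gt0 // lt_def b0 bmax_ge0.
have /andP[] := sum_upto_le t0 tu uK.
rewrite t_0 -/(polylog_trunc (2^-1 - q2) K _).
set S := sum_upto 0 K t; set X := _ + _ * polylog_trunc _ _ _ => S0 SX.
rewrite /n_gbs_i -[Q_haf2 _ _ _ _]/((d_of lambda)^-1 * S).
set mu := mu_haf2 K B a in hmu *.
have mu_neq0 : mu != 0 by rewrite -normr_gt0 (lt_trans hmu0).
have mule : mu0 ^+ 2 <= mu ^+ 2.
  by rewrite -[leRHS]real_normK ?num_real // lerXn2r ?nnegrE // ltW.
have mu2 : 0 < mu ^+ 2 by rewrite exprn_even_gt0.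
rewrite [leLHS](_ : _ = (d_of lambda * delta * eps ^+ 2)^-1 * (S / mu ^+ 2) -
    1 / (delta * eps ^+ 2)); last first.
  by field; rewrite mu_neq0 !gt_eqF.
rewrite lerD2r !div1r -[leRHS]mulrA; apply: ler_wpM2l.
  by rewrite invr_ge0 !mulr_ge0 ?sqr_ge0 // ltW.
(* Here [0 <= S <= X] is multiplied by [mu ^- 2 <= mu0 ^- 2]; the sign of [S] allows this. *)
rewrite [leRHS]mulrC; apply: ler_pM => //; first by rewrite invr_ge0 ltW.
by rewrite lef_pV2 ?posrE // exprn_gt0.
Qed.
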